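(* Assume (QP) has an optimal solution, let $\gamma\in(0,1)$, and let $\tau_p,\tau_d>0$ be problem-dependent error bound constants for (QP) (as defined in the context). Put $C_2=\sqrt{n/\gamma}+n$. Let $$\psi_d=\inf_{(y^*,s^* )\in\Omega_D}\ \min_{i\in\mathcal{S}(s^* )}s_i^*,$$ where $\Omega_D$ is the solution set of the dual problem in (QP), and assume $\psi_d>0$. Fix $C$ and a vector $\lambda\in\mathbb{R}^n$, $\lambda\ge0$, such that $$C=\frac{\psi_d}{2}\quad\text{and}\quad 0<\|\lambda\|<\min\left(1,\ \frac{\psi_d}{16\max(\tau_p,\tau_d)}\right).$$ Let $(x,y,s)\in\mathcal{N}_\lambda(\gamma)$ with $$\mu_\lambda<\min\left(1,\ \left(\frac{\psi_d}{4\max(\tau_p,\tau_d)\,C_2}\right)^2\right).$$ Then there exists an optimal solution $(x^*,y^*,s^* )$ of (QP) such that $$\bar{\mathcal{S}}_C(s)=\mathcal{S}(s^* ).$$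
   Context: Let $H\in\mathbb{R}^{n\times n}$ be symmetric positive semidefinite, $A\in\mathbb{R}^{m\times n}$ with $m\le n$, $b\in\mathbb{R}^m$, $c\in\mathbb{R}^n$. Vector inequalities are componentwise and $\|\cdot\|$ is the Euclidean norm. The pair (QP) consists of the primal problem $\min_x \frac12x^THx+c^Tx$ subject to $Ax=b$, $x\ge0$, and the dual problem $\max_{(x,y,s)} b^Ty-\frac12x^THx$ subject to $A^Ty+s-Hx=c$, $s\ge0$, $y$ free. A triple $(x^*,y^*,s^* )$ is an optimal solution of (QP) if and only if $Ax^*=b$, $A^Ty^*+s^*-Hx^*=c$, $x^*\ge0$, $s^*\ge0$ and $x_i^*s_i^*=0$ for all $i$. The dual solution set $\Omega_D$ is regarded as the set of pairs $(y^*,s^* )$ for which $(x,y^*,s^* )$ is an optimal solution of the dual problem for some $x$. For $\lambda\ge0$, $\mathcal{F}^0_\lambda=\{(x,y,s): Ax=b,\ A^Ty+s-Hx=c,\ x+\lambda>0,\ s+\lambda>0\}$. For a triple $(x,y,s)$, $\mu_\lambda=\frac{(x+\lambda)^T(s+\lambda)}{n}$. For $\gamma\in(0,1)$, $\mathcal{N}_\lambda(\gamma)=\{(x,y,s)\in\mathcal{F}^0_\lambda: \gamma\mu_\lambda\le(x_i+\lambda_i)(s_i+\lambda_i)\le\mu_\lambda/\gamma,\ i=1,\dots,n\}$. Problem-dependent error bound constants: $\tau_p,\tau_d>0$ are constants depending only on $(H,A,b,c)$ such that for every $\gamma\in(0,1)$, every $\lambda\ge0$ and every $(x,y,s)\in\mathcal{N}_\lambda(\gamma)$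 there is an optimal solution $(x^*,y^*,s^* )$ of (QP) with $\|x-x^*\|<\tau_p\,\beta$ and $\|s-s^*\|<\tau_d\,\beta$, where $\beta=(\sqrt{n/\gamma}+n)\sqrt{\mu_\lambda}\max(\sqrt{\mu_\lambda},1)+4\|\lambda\|\max(\|\lambda\|,1)$. (Such constants exist when (QP) has an optimal solution.) Sets (with $i$ ranging over $\{1,\dots,n\}$): $\mathcal{S}(s^* )=\{i:s_i^*>0\}$, $\bar{\mathcal{S}}_C(s)=\{i:s_i\ge C\}$. Convention: a minimum over the empty set is $+\infty$, and quantities involving $\psi_d$ are read in $[0,+\infty]$ (so $\bar{\mathcal{S}}_{+\infty}(s)=\emptyset$). *)

(* Defs.v *)
(* MathComp / MathComp-Analysis; the real numbers are any [R : realType]. *)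
From HB Require Import structures.
From mathcomp Require Import all_boot all_order all_algebra.
From mathcomp Require Import all_classical all_reals ereal.

Set Implicit Arguments.
Unset Strict Implicit.
Unset Printing Implicit Defensive.

Import Order.TTheory GRing.Theory Num.Theory.
Local Open Scope ring_scope.

Section Vectors.
Context {R : realType}.

Definition dotv n (u v : 'cV[R]_n) : R := (u^T *m v) 0 0.

(* The norm that the library puts on matrices is the sup norm. *)
Definition enorm n (u : 'cV[R]_n) : R := Num.sqrt (dotv u u).

Definition nonnegv n (u : 'cV[R]_n) : Prop := forall i, 0 <= u i 0.

Definition posv n (u : 'cV[R]_n) : Prop := forall i, 0 < u i 0.

Definition symmetric_psd n (H : 'M[R]_n) : Prop :=
  H^T = H /\ forall v : 'cV[R]_n, 0 <= dotv v (H *m v).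

Definition pos_index n (s : 'cV[R]_n) : {set 'I_n} := [set i | 0 < s i 0].

Definition large_index n (C : \bar R) (s : 'cV[R]_n) : {set 'I_n} :=
  [set i | (C <= (s i 0)%:E)%E].

(* [+oo] when no entry of [s] is positive. *)
Definition min_pos_entry n (s : 'cV[R]_n) : \bar R :=
  \big[mine/+oo%E]_(i in pos_index s) (s i 0)%:E.

End Vectors.

Section QuadraticProgram.
Context {R : realType} {m n : nat}.
Variables (H : 'M[R]_n) (A : 'M[R]_(m, n)) (b : 'cV[R]_m) (c : 'cV[R]_n).
Implicit Types (x s lambda : 'cV[R]_n) (y : 'cV[R]_m) (gamma : R).

(* A triple solves the primal-dual pair when it satisfies the KKT system;
   optimality for the dual problem alone is [dual_optimal]. *)
Definition qp_optimal x y s : Prop :=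
  [/\ A *m x = b, A^T *m y + s - H *m x = c, nonnegv x, nonnegv s
    & forall i, x i 0 * s i 0 = 0].

Definition dual_feasible x y s : Prop :=
  A^T *m y + s - H *m x = c /\ nonnegv s.

Definition dual_objective x y : R := dotv b y - 2^-1 * dotv x (H *m x).

Definition dual_optimal x y s : Prop :=
  dual_feasible x y s /\
  forall x' y' s', dual_feasible x' y' s' ->
    dual_objective x' y' <= dual_objective x y.

Definition Omega_D : set ('cV[R]_m * 'cV[R]_n) :=
  [set ys | exists x, dual_optimal x ys.1 ys.2]%classic.

Definition psi_d : \bar R :=
  ereal_inf [set min_pos_entry ys.2 | ys in Omega_D]%classic.

Definition shifted_interior lambda x y s : Prop :=
  [/\ A *m x = b, A^T *m y + s - H *m x = c,
      posv (x + lambda) & posv (s + lambda)].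

Definition mu lambda x s : R := dotv (x + lambda) (s + lambda) / n%:R.

Definition neighborhood lambda gamma x y s : Prop :=
  shifted_interior lambda x y s /\
  forall i, gamma * mu lambda x s <= (x + lambda) i 0 * (s + lambda) i 0
              <= mu lambda x s / gamma.

Definition C2 gamma : R := Num.sqrt (n%:R / gamma) + n%:R.

Definition beta lambda gamma x s : R :=
  C2 gamma * Num.sqrt (mu lambda x s) * Num.max (Num.sqrt (mu lambda x s)) 1
  + 4 * enorm lambda * Num.max (enorm lambda) 1.

Definition error_bound_constants (tau_p tau_d : R) : Prop :=
  [/\ 0 < tau_p, 0 < tau_d &
   forall gamma lambda x y s, 0 < gamma < 1 -> nonnegv lambda ->
     neighborhood lambda gamma x y s ->
     exists xs ys ss,
       [/\ qp_optimal xs ys ss,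
           enorm (x - xs) < tau_p * beta lambda gamma x s
         & enorm (s - ss) < tau_d * beta lambda gamma x s]].

End QuadraticProgram.

Arguments C2 {R} n gamma.

(* Main.v *)
(* By weak duality every KKT triple is dual optimal, so a positive entry of its
   [s]-part is at least [psi_d].  The error bound gives a KKT triple whose
   [s]-part is within [psi_d / 4 + psi_d / 4] of [s] (one quarter from each of
   the bounds on [mu] and [lambda]), so the threshold [psi_d / 2] separates its
   zero entries from its positive ones. *)
Require Import Defs.
From HB Require Import structures.
From mathcomp Require Import all_boot all_order all_algebra.
From mathcomp Require Import all_classical all_reals ereal.
From mathcomp Require Import ring lra.

Import Order.TTheory GRing.Theory Num.Theory.
Local Open Scope ring_scope.

Section Vectors.
Context {R : realType}.

Lemma dotvE n (u v : 'cV[R]_n) : dotv u v = \sum_i u i 0 * v i 0.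
Proof. by rewrite /dotv mxE; apply: eq_bigr => i _; rewrite mxE. Qed.

Lemma dotvC n (u v : 'cV[R]_n) : dotv u v = dotv v u.
Proof. by rewrite !dotvE; apply: eq_bigr => i _; rewrite mulrC. Qed.

Lemma dotvDr n (u v w : 'cV[R]_n) : dotv u (v + w) = dotv u v + dotv u w.
Proof. by rewrite /dotv mulmxDr mxE. Qed.

Lemma dotvNr n (u v : 'cV[R]_n) : dotv u (- v) = - dotv u v.
Proof. by rewrite /dotv mulmxN mxE. Qed.

Lemma dotv_trmx m n (M : 'M[R]_(m, n)) (u : 'cV[R]_n) (v : 'cV[R]_m) :
  dotv u (M^T *m v) = dotv (M *m u) v.
Proof. by rewrite /dotv trmx_mul mulmxA. Qed.

Lemma entry_le_enorm n (u : 'cV[R]_n) i : `|u i 0| <= enorm u.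
Proof.
rewrite -sqrtr_sqr ler_wsqrtr // dotvE (bigD1 i) //= expr2 lerDl.
by apply: sumr_ge0 => j _; rewrite -expr2 sqr_ge0.
Qed.

Lemma min_pos_entry_le n (s : 'cV[R]_n) i :
  0 < s i 0 -> (min_pos_entry s <= (s i 0)%:E)%E.
Proof. by move=> si; apply: bigmin_le_cond; rewrite inE. Qed.

End Vectors.

Section QuadraticProgram.
Context {R : realType} {m n : nat}.
Variables (H : 'M[R]_n) (A : 'M[R]_(m, n)) (b : 'cV[R]_m) (c : 'cV[R]_n).

(** Substituting both dual constraints and [A *m x = b], the objective at [(x, y)] exceeds that at
    [(x', y')] by [dotv x s'] plus half the quadratic form of [H] at [x - x']. Both terms are
    nonnegative. *)
Lemma qp_optimal_dual_optimal x y s :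
  symmetric_psd H -> qp_optimal H A b c x y s -> dual_optimal H A b c x y s.
Proof.
move=> [Hsym Hpsd] [Axb dxy x0 s0 xs0]; split=> // x' y' s' [dx'y' s'0].
have xs : dotv x s = 0 by rewrite dotvE big1.
have xs' : 0 <= dotv x s'.
  by rewrite dotvE sumr_ge0 // => i _; rewrite mulr_ge0.
have by_ : dotv b y = dotv x c + dotv x (H *m x).
  by rewrite -Axb -dotv_trmx -dxy !dotvDr dotvNr xs addr0 subrK.
have by' : dotv b y' = dotv x c + dotv x (H *m x') - dotv x s'.
  by rewrite -Axb -dotv_trmx -dx'y' !dotvDr dotvNr; ring.
have x'Hx : dotv x' (H *m x) = dotv x (H *m x').
  by rewrite -{1}Hsym dotv_trmx dotvC.
have := Hpsd (x - x').
rewrite mulmxBr dotvDr dotvNr ![dotv (x - x') _]dotvC !dotvDr !dotvNr.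
rewrite ![dotv (H *m _) _]dotvC x'Hx /dual_objective by_ by'.
lra.
Qed.

Lemma psi_d_le x y s i :
  symmetric_psd H -> qp_optimal H A b c x y s -> 0 < s i 0 ->
  (psi_d H A b c <= (s i 0)%:E)%E.
Proof.
move=> hH opt si; apply: le_trans (min_pos_entry_le _ _ _ si).
by apply: ereal_inf_lbound; exists (y, s) => //; exists x;
  apply: qp_optimal_dual_optimal.
Qed.

(** Below 1 both maxima in [beta] equal 1, which leaves one term for [mu] and one for [lambda], to
    be bounded separately. *)
Lemma beta_lt1 (lambda : 'cV[R]_n) gamma x s :
  mu lambda x s < 1 -> enorm lambda < 1 ->
  beta lambda gamma x s = C2 n gamma * Num.sqrt (mu lambda x s)
                          + 4 * enorm lambda.
Proof.
move=> mu1 l1; rewrite /beta !max_r ?mulr1 ?(ltW l1) //.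
by rewrite -[leRHS]sqrtr1 ler_wsqrtr // ltW.
Qed.

End QuadraticProgram.

Lemma C2_gt0 (R : realType) n (gamma : R) : (0 < n)%N -> 0 < C2 n gamma.
Proof. by move=> n0; rewrite ltr_wpDl ?sqrtr_ge0 ?ltr0n. Qed.

Theorem theorem9 (R : realType) (m n : nat) (hmn : (m <= n)%N)
    (H : 'M[R]_n) (A : 'M[R]_(m, n)) (b : 'cV[R]_m) (c : 'cV[R]_n)
    (hH : symmetric_psd H)
    (hopt : exists x0 y0 s0, qp_optimal H A b c x0 y0 s0)
    (gamma : R) (hgamma : 0 < gamma < 1)
    (tau_p tau_d : R) (htau : error_bound_constants H A b c tau_p tau_d)
    (hpsi : (0 < psi_d H A b c)%E)
    (C : \bar R) (hC : C = (psi_d H A b c / 2%:E)%E)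
    (lambda : 'cV[R]_n) (hlambda : nonnegv lambda)
    (hlambda_gt0 : 0 < enorm lambda)
    (hlambda_lt : ((enorm lambda)%:E <
       mine 1 (psi_d H A b c / (16 * Num.max tau_p tau_d)%:E))%E)
    (x : 'cV[R]_n) (y : 'cV[R]_m) (s : 'cV[R]_n)
    (hN : neighborhood H A b c lambda gamma x y s)
    (hmu : ((mu lambda x s)%:E <
       mine 1 ((psi_d H A b c / (4 * Num.max tau_p tau_d * C2 n gamma)%:E)
               ^+ 2))%E) :
  exists (xs : 'cV[R]_n) (ys : 'cV[R]_m) (ss : 'cV[R]_n),
    qp_optimal H A b c xs ys ss /\ large_index C s = pos_index ss.
Proof.
have [tp0 td0 /(_ _ _ _ _ _ hgamma hlambda hN)[xs [ys [ss [opt _ sss]]]]] := htau.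
exists xs, ys, ss; split=> //.
have psi_le i := psi_d_le _ _ _ _ _ _ _ i hH opt.
have ss0 : nonnegv ss by case: opt.
(* In dimension 0 the norm of [lambda] is the root of an empty sum, hence 0. Positivity of [n] makes
   [C2 n gamma], a factor of a denominator below, nonzero. *)
have n0 : (0 < n)%N.
  rewrite lt0n; apply: contraTneq hlambda_gt0 => n0.
  rewrite /enorm dotvE big1 ?sqrtr0 ?ltxx // => i _.
  by have := ltn_ord i; rewrite {2}n0.
have C20 := C2_gt0 R n gamma n0.
set M := Num.max tau_p tau_d in hlambda_lt hmu.
have tdM : tau_d <= M by rewrite le_max lexx orbT.
have M0 : 0 < M := lt_le_trans td0 tdM.
move: hlambda_lt hmu; rewrite !lt_min => /andP[l1 ll] /andP[mu1 mul].
rewrite (beta_lt1 _ _ _ _ mu1 l1) in sss.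
apply/setP => i; rewrite !inE hC; move: hpsi psi_le ll mul.
case: (psi_d H A b c) => [psi| |] //.
- rewrite lte_fin => psi0 psi_le.
  (* The extended inverse treats 0 as a special case; positive denominators exclude it, and
     everything descends to [R]. *)
  rewrite !inver !gt_eqF ?mulr_gt0 // -!EFinM -EFin_expe !lte_fin lee_fin.
  move=> ll mul.
  set k := 4 * M * C2 n gamma in mul.
  have k0 : 0 < k by rewrite !mulr_gt0.
  (* The positive number [psi / k] is rewritten as the root of its square, so the bound on [mu]
     passes under the root. *)
  have sqmu : Num.sqrt (mu lambda x s) < psi / k.
    have pk0 : 0 < psi / k by rewrite divr_gt0.
    by rewrite -(ger0_norm (ltW pk0)) -sqrtr_sqr ltr_sqrt // exprn_gt0.
  have b1 : M * (C2 n gamma * Num.sqrt (mu lambda x s)) < psi / 4.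
    move: sqmu; rewrite ltr_pdivlMr // /k; lra.
  (* The constant 16 splits as 4 * 4: the coefficient 4 of [enorm lambda] in [beta], and the quarter
     of [psi]. *)
  have b2 : M * (4 * enorm lambda) < psi / 4.
    move: ll; rewrite ltr_pdivlMr ?mulr_gt0 //; lra.
  have close : `|s i 0 - ss i 0| < psi / 2.
    have := entry_le_enorm _ (s - ss) i; rewrite !mxE => /le_lt_trans; apply.
    apply: (lt_le_trans sss).
    have : tau_d * (C2 n gamma * Num.sqrt (mu lambda x s) + 4 * enorm lambda)
        <= M * (C2 n gamma * Num.sqrt (mu lambda x s) + 4 * enorm lambda).
      by rewrite ler_wpM2r // addr_ge0 ?mulr_ge0 ?sqrtr_ge0 // ltW.
    by rewrite [in leRHS]mulrDr; lra.
  move: close; rewrite ltr_norml => /andP[lo hi].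
  (* If [ss i 0] is positive it is at least [psi], so [s i 0] stays above [psi / 2]. Otherwise the
     strictness of [close] keeps [s i 0] below the threshold, which itself counts as large. *)
  have [ssi|ssi] := ltP 0 (ss i 0).
    by have := psi_le _ ssi; rewrite lee_fin; lra.
  by apply/negbTE; rewrite -ltNge; lra.
(* When [psi_d] is [+oo] so is [C], and both index sets are empty: no real entry reaches [+oo], and
   a positive entry of [ss] would have to be at least [+oo]. *)
- move=> _ psi_le _ _.
  rewrite inver gt_eqF // gt0_mulye ?lte_fin ?invr_gt0 // leye_eq /=.
  by apply/esym/negbTE/negP => /psi_le; rewrite leye_eq.
Qed.
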